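(* Let $A=\begin{pmatrix}G\\H\end{pmatrix}\in\mathbb{R}^{n\times m}$ with $G\in\mathbb{R}^{p\times m}$, $H\in\mathbb{R}^{q\times m}$, $n=p+q$, $A$ of full column rank, $B:=H^\top H$ positive definite, $P:=\{1,\dots,p\}$, $Q:=\{p+1,\dots,n\}$, and $0<s-q<p$. Then the $\Gamma$-bound for the D-optimality problem $$\max\big\{\operatorname{ldet}(A^\top\operatorname{Diag}(x)A):\mathbf{e}^\top x=s,\ x_i=1\ (i\in Q),\ x\in\{0,1\}^n\big\}$$ equals the complementary $\Gamma$-bound $\mathfrak{z}_{\text{c-}\Gamma}$ for the corresponding Data-Fusion problem $$\max\big\{\operatorname{ldet}(B+G^\top\operatorname{Diag}(x)G):\mathbf{e}^\top x=s-q,\ x\in\{0,1\}^p\big\}.$$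
   Context: $\mathbf{e}$ is the all-ones vector of appropriate dimension; $\operatorname{ldet}$ is log-determinant; $\operatorname{Diag}(x)$ is the diagonal matrix with diagonal $x$. The $\Gamma$-function: for $\lambda\in\mathbb{R}_+^k$ with $\lambda_1\ge\dots\ge\lambda_k$ and an integer $t$ with $0<t\le k$, there is a unique integer $\iota$ with $0\le\iota<t$ such that $\lambda_\iota>\frac{1}{t-\iota}\sum_{\ell=\iota+1}^k\lambda_\ell\ge\lambda_{\iota+1}$, with the convention $\lambda_0=+\infty$. Define $\phi_t(\lambda):=\sum_{\ell=1}^{\iota}\log(\lambda_\ell)+(t-\iota)\log\big(\frac{1}{t-\iota}\sum_{\ell=\iota+1}^k\lambda_\ell\big)$, with $\log(0)=-\infty$. For a symmetric positive-semidefinite $k\times k$ matrix $X$, $\Gamma_t(X):=\phi_t(\lambda(X))$, where $\lambda(X)$ is the vector of eigenvalues of $X$ in nonincreasing order. $\Gamma$-bound: let $A=U\Sigma V^\top$ be the compact real singular-value decomposition ($U\in\mathbb{R}^{n\times m}$, $\Sigma\in\mathbb{R}^{m\times m}$ diagonal, $V\in\mathbb{R}^{m\times m}$, $U^\top U=V^\top V=VV^\top=I_m$) and let $W\in\mathbb{R}^{n\times(n-m)}$ satisfy $I_n-UU^\top=WW^\top$. The $\Gamma$-bound for the D-optimality problem above, in which the variables $x_i$, $i\in Q$, are fixed at one (so the complementary variables $y_i$, $i\in Q$, are fixed at zero), is $$2\sum_{i=1}^m\log(\Sigma_{ii})+\max\big\{\Gamma_{n-s}(W^\top\operatorname{Diag}(y)W):\mathbf{e}^\top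 y=n-s,\ 0\le y\le\mathbf{e},\ y_i=0\ (i\in Q)\big\}.$$ Complementary $\Gamma$-bound: let $\Phi\Phi^\top$ be the Cholesky factorization of the positive-definite matrix $I_p-G(B+G^\top G)^{-1}G^\top$, and let $\phi_i^\top$ be the $i$-th row of $\Phi$, $i\in P$. Then $$\mathfrak{z}_{\text{c-}\Gamma}:=\operatorname{ldet}(B+G^\top G)+\max\Big\{\Gamma_{p-(s-q)}\Big(\sum_{i\in P}z_i\phi_i\phi_i^\top\Big):\mathbf{e}^\top z=p-(s-q),\ 0\le z_i\le1\ (i\in P)\Big\}.$$ *)

(* Defs.v *)
From mathcomp Require Import all_boot all_order all_algebra.
From mathcomp Require Import all_classical all_reals all_analysis.
Set Implicit Arguments.
Unset Strict Implicit.
Unset Printing Implicit Defensive.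
Import Order.TTheory GRing.Theory Num.Theory.
Local Open Scope classical_set_scope.
Local Open Scope ring_scope.

Section GammaBounds.
Variable R : realType.

Definition posdefmx n (X : 'M[R]_n) : Prop :=
  X^T = X /\ forall v : 'cV[R]_n, v != 0 -> 0 < (v^T *m X *m v) 0 0.

(* [lne x%:E] is [(ln x)%:E] for [0 < x] and [-oo] for [x <= 0]. *)
Definition ldet n (X : 'M[R]_n) : \bar R := lne (\det X)%:E.

(* The roots of the characteristic polynomial with multiplicity, in
   nonincreasing order; the default value is irrelevant for symmetric X,
   whose characteristic polynomial splits over R. *)
Definition eigenvalues k (X : 'M[R]_k) : k.-tuple R :=
  xget [tuple of nseq k 0]
    [set lam : k.-tuple R | sorted >=%R lam /\
       char_poly X = \prod_(x <- lam) ('X - x%:P)].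

(* lambda_l with indices starting at 1 and lambda_0 = +oo. *)
Definition entry k (lam : k.-tuple R) (l : nat) : \bar R :=
  if l is j.+1 then (lam`_j)%:E else +oo%E.

(* (1 / (t - i)) * (lambda_{i+1} + ... + lambda_k) *)
Definition tail_mean k (t : nat) (lam : k.-tuple R) (i : nat) : R :=
  (\sum_(i <= j < k) lam`_j) / (t - i)%:R.

Definition is_split k (t : nat) (lam : k.-tuple R) (i : nat) : Prop :=
  (i < t)%N /\
  ((tail_mean t lam i)%:E < entry lam i)%E /\
  (entry lam i.+1 <= (tail_mean t lam i)%:E)%E.

(* For nonnegative nonincreasing lam and 0 < t <= k, exactly one index
   satisfies [is_split t lam], so the default is never used. *)
Definition split_index k (t : nat) (lam : k.-tuple R) : nat :=
  xget 0%N [set i | is_split t lam i].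

Definition phi k (t : nat) (lam : k.-tuple R) : \bar R :=
  let i := split_index t lam in
  (\sum_(0 <= j < i) lne (lam`_j)%:E
   + (t - i)%:R%:E * lne (tail_mean t lam i)%:E)%E.

Definition Gamma k (t : nat) (X : 'M[R]_k) : \bar R := phi t (eigenvalues X).

Definition is_max (S : set (\bar R)) (v : \bar R) : Prop := S v /\ ubound S v.

(* Compact singular-value decomposition of a matrix of rank m. *)
Definition compact_svd n m (A : 'M[R]_(n, m)) (U : 'M[R]_(n, m))
    (Sigma V : 'M[R]_m) : Prop :=
  [/\ A = U *m Sigma *m V^T,
      is_diag_mx Sigma /\ (forall i, 0 < Sigma i i),
      U^T *m U = 1%:M
    & V^T *m V = 1%:M /\ V *m V^T = 1%:M].

Definition cholesky p (Phi X : 'M[R]_p) : Prop :=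
  [/\ is_trig_mx Phi, forall i, 0 < Phi i i & Phi *m Phi^T = X].

(* The bounds are rendered as relations "v is the value of the bound", so that
   "max" keeps its meaning of an attained maximum. *)
Definition is_Gamma_bound n m (s : nat) (Q : {set 'I_n}) (Sigma : 'M[R]_m)
    (W : 'M[R]_(n, n - m)) (v : \bar R) : Prop :=
  exists2 M : \bar R,
    is_max [set Gamma (n - s) (W^T *m diag_mx y *m W) | y in
      [set y : 'rV[R]_n | [/\ \sum_i y 0 i = (n - s)%:R,
                              forall i, 0 <= y 0 i <= 1
                            & forall i, i \in Q -> y 0 i = 0]]] M
  & v = ((2 * \sum_i ln (Sigma i i))%:E + M)%E.

(* The bound for  max ldet (B + G^T Diag(x) G)  over x in {0,1}^p with
   e^T x = r, where Phi is the Cholesky factor of [cGamma_mx G B]. *)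
Definition cGamma_mx p m (G : 'M[R]_(p, m)) (B : 'M[R]_m) : 'M[R]_p :=
  1%:M - G *m invmx (B + G^T *m G) *m G^T.

Definition is_cGamma_bound p m (r : nat) (G : 'M[R]_(p, m)) (B : 'M[R]_m)
    (Phi : 'M[R]_p) (v : \bar R) : Prop :=
  exists2 M : \bar R,
    is_max [set Gamma (p - r)
        (\sum_i z 0 i *: ((row i Phi)^T *m row i Phi)) | z in
      [set z : 'rV[R]_p | \sum_i z 0 i = (p - r)%:R /\
                          forall i, 0 <= z 0 i <= 1]] M
  & v = (ldet (B + G^T *m G) + M)%E.

End GammaBounds.

(* Main.v *)
(* Both matrices inside Gamma have the same characteristic polynomial up to a
   power of X: chi(AB) X^n = chi(BA) X^m reduces W^T Diag(z, 0) W and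
   Phi^T Diag(z) Phi to the leading block of Diag(z, 0) W W^T, and
   W W^T = 1 - A (A^T A)^-1 A^T has leading block Phi Phi^T.  Extra zero
   eigenvalues do not change phi_t for t <= p, so the two maxima range over the
   same set of values.  The additive constants agree because
   A^T A = B + G^T G has determinant (prod Sigma_ii)^2.

   That the maximum is attained is not obvious, since phi_t depends on sorted
   eigenvalues and on the index iota.  By AM-GM,
     exp (phi_t lam) = max { prod mu_j : mu in R^t, mu_j >= lam_j,
                             sum mu = sum lam },
   so one maximises the polynomial prod mu_j over the compact set of triples
   (z, lam, mu) for which lam is sorted, chi(X z) = prod ('X - lam_i), and mu
   satisfies these constraints. *)
Require Import Defs.
From mathcomp Require Import all_boot all_order all_algebra.
From mathcomp Require Import all_classical all_reals all_analysis.
From mathcomp Require Import lra zify complex.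
Set Implicit Arguments.
Unset Strict Implicit.
Unset Printing Implicit Defensive.
Import Order.TTheory GRing.Theory Num.Theory.
Import numFieldNormedType.Exports.
Local Open Scope classical_set_scope.
Local Open Scope ring_scope.

(** * Characteristic polynomials of products and block matrices *)

Lemma horner_ext (F : numDomainType) (p q : {poly F}) :
  (forall x, p.[x] = q.[x]) -> p = q.
Proof.
move=> pq; apply/eqP; rewrite -subr_eq0; apply/eqP.
(* In characteristic zero the integers [0], ..., [size (p - q) - 1] are distinct; as roots they
   outnumber the degree of [p - q]. *)
pose rs : seq F := [seq i%:R | i <- iota 0 (size (p - q))].
apply: (@roots_geq_poly_eq0 _ _ rs).
- by apply/allP => x _; rewrite rootE hornerD hornerN pq subrr.
- by rewrite map_inj_uniq ?iota_uniq// => i j /eqP; rewrite eqr_nat => /eqP.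
- by rewrite size_map size_iota.
Qed.

Lemma horner_char_poly (F : comNzRingType) n (A : 'M[F]_n) x :
  (char_poly A).[x] = \det (x%:M - A).
Proof.
rewrite /char_poly -horner_evalE -det_map_mx; congr (\det _).
apply/matrixP => i j; rewrite !mxE /= /horner_eval.
by rewrite hornerD hornerN hornerC hornerMn hornerX.
Qed.

(** Block elimination on [K] from the right gives [\det K = \det (x - AB)]; from the left, with a
    factor of determinant [x ^+ n], it gives [x ^+ m * \det (x - BA)]. Nothing is divided by [x], so
    [x = 0] is covered. *)
Lemma det_scalar_sub_mulmxC (F : comNzRingType) m n (A : 'M[F]_(m, n))
    (B : 'M[F]_(n, m)) (x : F) :
  \det (x%:M - A *m B) * x ^+ n = \det (x%:M - B *m A) * x ^+ m.
Proof.
pose K := block_mx x%:M A B 1%:M.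
have KL : K *m block_mx 1%:M 0 (- B) 1%:M = block_mx (x%:M - A *m B) A 0 1%:M.
  rewrite mulmx_block !mulmx1 !mulmx0 !mul1mx !add0r mulmxN.
  by rewrite subrr.
have KR : block_mx 1%:M 0 (- B) x%:M *m K = block_mx x%:M A 0 (x%:M - B *m A).
  rewrite mulmx_block !mulmx1 !mul1mx !mul0mx !addr0 mulNmx mulNmx.
  by rewrite scalar_mxC addNr addrC.
have := congr1 determinant KL; have := congr1 determinant KR.
rewrite !det_mulmx !det_lblock !det_ublock !det1 !det_scalar !mulr1 !mul1r.
by move=> E <-; rewrite mulrC E mulrC.
Qed.

Lemma char_poly_mulmxC (F : numDomainType) m n (A : 'M[F]_(m, n))
    (B : 'M[F]_(n, m)) :
  char_poly (A *m B) * 'X^n = char_poly (B *m A) * 'X^m.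
Proof.
apply: horner_ext => x; rewrite !hornerM !hornerXn !horner_char_poly.
exact: det_scalar_sub_mulmxC.
Qed.

Lemma char_poly_ublock0 (F : numDomainType) p q (A : 'M[F]_p)
    (B : 'M[F]_(p, q)) :
  char_poly (block_mx A B 0 0) = char_poly A * 'X^q.
Proof.
apply: horner_ext => x; rewrite hornerM hornerXn !horner_char_poly.
rewrite scalar_mx_block opp_block_mx add_block_mx !oppr0 !addr0.
by rewrite det_ublock det_scalar.
Qed.

Lemma char_poly_simmx (F : numFieldType) n (P A : 'M[F]_n) :
  P \in unitmx -> char_poly (invmx P *m A *m P) = char_poly A.
Proof.
move=> Pu; apply: (@mulIf _ 'X^n); first by rewrite -size_poly_gt0 size_polyXn.
by rewrite char_poly_mulmxC mulmxA mulmxV// mul1mx.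
Qed.

Lemma ln_prod (R : realType) I (r : seq I) (P : pred I) (F : I -> R) :
  (forall i, P i -> 0 < F i) ->
  ln (\prod_(i <- r | P i) F i) = \sum_(i <- r | P i) ln (F i).
Proof.
(* [K] carries positivity through the induction, because [lnM] needs both factors positive. *)
move=> F0; pose K (x y : R) := 0 < x /\ ln x = y.
suff [] : K (\prod_(i <- r | P i) F i) (\sum_(i <- r | P i) ln (F i)) by [].
apply: (big_ind2 K) => [|x u y v [x0 <-] [y0 <-]|i /F0 Fi].
- by split; [exact: ltr01|exact: ln1].
- by split; [exact: mulr_gt0|rewrite lnM].
- by split.
Qed.

(** * Spectra of positive-semidefinite matrices *)

Section Spectrum.
Variable R : realType.

(** Row vectors match the left eigenvectors supplied by [eigenvalueP]. *)
Definition possemidefmx n (X : 'M[R]_n) : Prop :=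
  X^T = X /\ forall v : 'rV[R]_n, 0 <= (v *m X *m v^T) 0 0.

(** Over the complex numbers [X] is Hermitian, so it is unitarily diagonalizable with a real
    diagonal; the factorization descends because the embedding of polynomials is injective. *)
Lemma char_poly_sym_split n (X : 'M[R]_n) : X^T = X ->
  exists r : seq R, char_poly X = \prod_(x <- r) ('X - x%:P).
Proof.
move=> Xsym; pose A := map_mx (@real_complex_def R (Phant R)) X.
have Ah : A \is hermsymmx.
  apply: realsym_hermsym.
    apply/is_hermitianmxP; rewrite expr0 scale1r map_mx_id//.
    by apply/matrixP => i j; rewrite !mxE -[in LHS]Xsym mxE.
  by apply/mxOverP => i j; rewrite mxE; apply/complex_realP; exists (X i j).
have /mxOverP dreal := hermitian_spectral_diag_real Ah.
have /orthomx_spectralP AE := hermitian_normalmx Ah.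
pose r := [seq complex.Re (spectral_diag A 0 i) | i <- enum 'I_n].
exists r; apply: (@map_poly_inj _ _ (@real_complex_def R (Phant R))).
rewrite map_char_poly -/A AE char_poly_simmx ?spectral_unit//.
rewrite char_poly_trig ?diag_mx_is_trig// rmorph_prod /= big_map big_enum/=.
apply: eq_bigr => i _; rewrite rmorphB/= map_polyX map_polyC/= !mxE eqxx mulr1n.
by have /complex_realP[y ->] := dreal 0 i.
Qed.

Lemma possemidef_root_ge0 n (X : 'M[R]_n) a :
  possemidefmx X -> root (char_poly X) a -> 0 <= a.
Proof.
move=> [_ Xp]; rewrite -eigenvalue_root_char => /eigenvalueP[v vX v0].
have := Xp v; rewrite vX -scalemxAl mxE.
suff vv : 0 < (v *m v^T) 0 0 by rewrite pmulr_lge0.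
rewrite mxE lt_neqAle; apply/andP; split; last first.
  by apply: sumr_ge0 => i _; rewrite mxE -expr2 sqr_ge0.
apply: contraNneq v0 => /esym /psumr_eq0P h; apply/eqP/rowP => i.
have := h _ i isT; rewrite !mxE => /(_ _)/eqP; rewrite mulf_eq0 orbb => h'.
apply/eqP/h' => j _; rewrite mxE -expr2 sqr_ge0//.
Qed.

Lemma sorted_ge_eq (r s : seq R) : sorted >=%R r -> sorted >=%R s ->
  perm_eq r s -> r = s.
Proof.
exact: sorted_eq ge_trans ge_anti _ _.
Qed.

Definition is_spectrum k (X : 'M[R]_k) (lam : k.-tuple R) : Prop :=
  [/\ sorted >=%R lam, all (fun x => 0 <= x) lam
    & char_poly X = \prod_(x <- lam) ('X - x%:P)].

(** The characteristic polynomial fixes the multiset of roots and sorting fixes their order, so the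
    choice made by [xget] is determined. *)
Lemma eigenvalues_uniq k (X : 'M[R]_k) (lam : k.-tuple R) :
  is_spectrum X lam -> eigenvalues X = lam.
Proof.
move=> [lamS _ XE]; apply: val_inj; rewrite /eigenvalues.
case: xgetP => [mu _ [muS XE']|/(_ lam)]; last by case.
by apply: sorted_ge_eq => //; apply: prod_XsubC_eq; rewrite -XE -XE'.
Qed.

Lemma eigenvalues_spectrum k (X : 'M[R]_k) :
  possemidefmx X -> is_spectrum X (eigenvalues X).
Proof.
move=> Xp; have [r XE] := char_poly_sym_split Xp.1.
have sr : size (sort >=%R r) == k.
  rewrite size_sort; have := size_char_poly X.
  by rewrite XE size_prod_XsubC => -[->].
suff sp : is_spectrum X (Tuple sr) by rewrite (eigenvalues_uniq sp).
have perm : perm_eq (sort >=%R r) r by rewrite perm_sort.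
split => //=.
- by apply: sort_sorted => x y; exact: real_leVge (num_real _) (num_real _).
- apply/allP => x; rewrite (perm_mem perm) => xr.
  by apply: possemidef_root_ge0 Xp _; rewrite XE root_prod_XsubC.
- by rewrite XE; apply: esym; apply: perm_big.
Qed.

End Spectrum.

(** * The index iota and the value of phi *)

Section Split.
Variables (R : realType) (k t : nat) (lam : k.-tuple R).
Hypotheses (t_gt0 : (0 < t)%N) (le_tk : (t <= k)%N).
Hypotheses (lam_sorted : sorted >=%R lam) (lam_ge0 : all (fun x => 0 <= x) lam).

Lemma nth_spectrum_ge0 j : 0 <= lam`_j.
Proof.
have [jk|kj] := ltnP j k; last by rewrite nth_default ?size_tuple.
by apply: (allP lam_ge0); rewrite mem_nth ?size_tuple.
Qed.

(** No bound on [j] is required: past the end [nth] returns 0, which is below every entry. *)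
Lemma nth_spectrum_antitone i j : (i <= j)%N -> lam`_j <= lam`_i.
Proof.
move=> ij; have [jk|kj] := ltnP j k; last first.
  by rewrite nth_default ?size_tuple// nth_spectrum_ge0.
apply: (sorted_leq_nth ge_trans _ 0 lam_sorted) => //; first exact: lexx.
  by rewrite inE size_tuple (leq_ltn_trans ij).
by rewrite inE size_tuple.
Qed.

Lemma tail_mean_ge0 i : 0 <= tail_mean t lam i.
Proof.
by rewrite divr_ge0// sumr_ge0// => j _; exact: nth_spectrum_ge0.
Qed.

Lemma tail_meanM i : (i < t)%N ->
  (t - i)%:R * tail_mean t lam i = \sum_(i <= j < k) lam`_j.
Proof.
by move=> it; rewrite mulrC divfK// pnatr_eq0 -lt0n subn_gt0.
Qed.

(** Take the least [i < t] with [lam_i] (counted from 0) at most the tail mean. The index [t - 1]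
    qualifies, since its tail mean is the whole tail sum, which is at least its first term.
    Minimality yields the strict inequality on the left. *)
Lemma exists_split : exists i, is_split t lam i.
Proof.
pose P i := (i < t)%N && (lam`_i <= tail_mean t lam i).
have exP : exists i, P i.
  exists t.-1; rewrite /P prednK// leqnn /=.
  have -> : tail_mean t lam t.-1 = \sum_(t.-1 <= j < k) lam`_j.
    by rewrite /tail_mean (_ : (t - t.-1 = 1)%N) ?divr1//; lia.
  rewrite big_ltn; last by lia.
  by rewrite lerDl sumr_ge0// => j _; exact: nth_spectrum_ge0.
case: (ex_minnP exP) => i /andP[it hi] imin; exists i; split => //; split => //.
case: i it hi imin => [|i] it hi imin /=; first by rewrite ltry.
rewrite lte_fin ltNge; apply/negP => hle.
have : ~~ P i by apply/negP => /imin; rewrite ltnn.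
rewrite /P (ltnW it) /= -ltNge => hlt.
(* The mean at [i] is the weighted average of [lam_i] (weight 1) and the mean at [i + 1] (weight
   [t - i - 1]). By [hle] it is at least [lam_i], contradicting [hlt]. *)
have M := tail_meanM it.
have M' := tail_meanM (ltnW it).
rewrite big_ltn ?(leq_trans _ le_tk) 1?ltnW// -M in M'.
have E : (t - i)%:R = (t - i.+1)%:R + 1 :> R.
  by rewrite natr1; congr (_%:R); lia.
have p1 : 0 < (t - i.+1)%:R :> R by rewrite ltr0n subn_gt0.
rewrite E in M'; nra.
Qed.

(** * The leveled vector maximises the product *)

Section Level.
Variable i : nat.
Hypothesis iP : is_split t lam i.

(* The vector whose product is [exp (phi t lam)]. *)
Definition leveled j := if (j < i)%N then lam`_j else tail_mean t lam i.

Lemma tail_mean_lt j : (j < i)%N -> tail_mean t lam i < lam`_j.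
Proof.
case: iP => _ []; case: i => // i' /=.
rewrite lte_fin => h _; rewrite ltnS => ji.
exact: lt_le_trans h (nth_spectrum_antitone ji).
Qed.

Lemma le_tail_mean j : (i <= j)%N -> lam`_j <= tail_mean t lam i.
Proof.
case: iP => _ [_]; rewrite /= lee_fin => h ij.
exact: le_trans (nth_spectrum_antitone ij) h.
Qed.

Lemma leveled_ge j : lam`_j <= leveled j.
Proof. by rewrite /leveled; case: ltnP => // /le_tail_mean. Qed.

Lemma leveled_ge0 j : 0 <= leveled j.
Proof. exact: le_trans (nth_spectrum_ge0 j) (leveled_ge j). Qed.

Lemma leveled_sum : \sum_(j < t) leveled j = \sum_(x <- lam) x.
Proof.
have it := iP.1.
rewrite (big_nth 0) size_tuple -(big_mkord predT leveled).
have ik : (i <= k)%N by rewrite (leq_trans (ltnW it)).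
rewrite (big_cat_nat _ (ltnW it))//= [RHS](big_cat_nat _ ik)//=.
congr (_ + _).
  by apply: eq_big_nat => j /andP[_ ji]; rewrite /leveled ji.
rewrite -tail_meanM// mulr_natl -sumr_const_nat.
by apply: eq_big_nat => j /andP[ij _]; rewrite /leveled ltnNge ij.
Qed.

(** The upper-bound half of the AM-GM description of phi; [leveled_ge] and [leveled_sum] say that
    [leveled] is itself feasible. *)
Lemma prod_le_leveled (mu : 'I_t -> R) :
  (forall j : 'I_t, lam`_j <= mu j) -> \sum_j mu j = \sum_(x <- lam) x ->
  \prod_j mu j <= \prod_(j < t) leveled j.
Proof.
move=> mu_ge mu_sum; have it := iP.1.
have mu_ge0 j : 0 <= mu j by apply: le_trans (mu_ge j); exact: nth_spectrum_ge0.
set m := tail_mean t lam i; have := tail_mean_ge0 i; rewrite -/m.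
rewrite le_eqVlt => /orP[/eqP m0|m_gt0].
  (* With zero tail mean, [mu] dominates [leveled] entrywise and has the same sum, so they coincide;
     entry [i] is then 0 and kills the product. *)
  suff -> : \prod_j mu j = 0 by apply: prodr_ge0 => j _; exact: leveled_ge0.
  have d_ge0 (j : 'I_t) : predT j -> 0 <= mu j - leveled j.
    by rewrite subr_ge0 /leveled; case: ifP => // _; rewrite -/m -m0.
  have sum0 : \sum_(j < t) (mu j - leveled j) = 0.
    by rewrite sumrB mu_sum leveled_sum subrr.
  have := psumr_eq0P d_ge0 sum0 (i := Ordinal it) isT.
  rewrite /leveled /= ltnn -/m -m0 subr0 => mu0.
  by rewrite (bigD1 (Ordinal it))//= mu0 mul0r.
have nu_gt0 j : 0 < leveled j.
  rewrite /leveled; case: ifP => // ji; apply: lt_trans (tail_mean_lt ji).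
  exact: m_gt0.
(* For j < i, mu_j >= lam_j = leveled j > m, so dividing mu_j - leveled j by
   leveled j gives at most what dividing it by m does, and the numerators sum
   to 0; AM-GM then bounds prod (mu_j / leveled j). *)
pose E (j : 'I_t) := mu j / leveled j.
have sumE : \sum_j E j <= t%:R.
  rewrite -subr_le0 -[t in t%:R]card_ord -sumr_const -sumrB.
  apply: (@le_trans _ _ (\sum_(j < t) (mu j - leveled j) / m)); last first.
    by rewrite -mulr_suml sumrB mu_sum leveled_sum subrr mul0r.
  apply: ler_sum => j _; rewrite /E.
  rewrite -[X in _ - X](divff (lt0r_neq0 (nu_gt0 j))) -mulrBl.
  rewrite /leveled; case: ifP => // ji; apply: ler_wpM2l.
    by rewrite subr_ge0.
  rewrite lef_pV2 ?posrE// ?ltW ?tail_mean_lt//.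
  exact: lt_trans m_gt0 (tail_mean_lt ji).
have : \prod_j E j <= 1.
  have E_ge0 j : 0 <= E j by rewrite divr_ge0// ltW.
  have [le_AGM _] := @leif_AGM R 'I_t predT E (fun j _ => E_ge0 j).
  apply: le_trans le_AGM _; rewrite card_ord.
  apply: exprn_ile1; first by rewrite divr_ge0// sumr_ge0.
  by rewrite ler_pdivrMr ?ltr0n// mul1r.
by rewrite prodf_div ler_pdivrMr ?mul1r// prodr_gt0.
Qed.

Lemma lne_prod_leveled :
  (\sum_(0 <= j < i) lne (lam`_j)%:E
   + (t - i)%:R%:E * lne (tail_mean t lam i)%:E)%E
  = lne (\prod_(j < t) leveled j)%:E.
Proof.
have it := iP.1.
have lam_gt0 j : (j < i)%N -> 0 < lam`_j.
  by move=> /tail_mean_lt; apply: le_lt_trans; exact: tail_mean_ge0.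
have -> : \prod_(j < t) leveled j =
    \prod_(j < i) lam`_j * tail_mean t lam i ^+ (t - i).
  rewrite -(big_mkord predT leveled) (big_cat_nat _ (ltnW it))//=.
  congr (_ * _).
    by rewrite big_mkord; apply: eq_bigr => j _; rewrite /leveled ltn_ord.
  rewrite -prodr_const_nat.
  by apply: eq_big_nat => j /andP[ij _]; rewrite /leveled ltnNge ij.
have -> : (\sum_(0 <= j < i) lne (lam`_j)%:E)%E = (ln (\prod_(j < i) lam`_j))%:E.
  rewrite ln_prod//; last by move=> j _; exact: lam_gt0.
  rewrite -sumEFin big_mkord; apply: eq_bigr => j _.
  by rewrite lne_EFin// lam_gt0.
have p_gt0 : 0 < \prod_(j < i) lam`_j by apply: prodr_gt0 => j _; rewrite lam_gt0.
(* If the tail mean is 0, both sides are [-oo]: the first sum is finite because its entries are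
   positive, and the exponent [t - i] is positive. *)
have := tail_mean_ge0 i; rewrite le_eqVlt => /orP[/eqP<-|m_gt0].
  rewrite expr0n subn_eq0 leqNgt it /= mulr0 !lexx.
  by rewrite muleC gt0_mulNye// lte_fin ltr0n subn_gt0.
move: (tail_mean t lam i) m_gt0 => m m_gt0.
rewrite !lne_EFin ?mulr_gt0 ?exprn_gt0//.
by rewrite lnM ?posrE ?exprn_gt0// lnXn// -EFinM mulr_natl.
Qed.

End Level.

Lemma phi_leveled : exists i,
  is_split t lam i /\ phi t lam = lne (\prod_(j < t) leveled i j)%:E.
Proof.
rewrite /phi /split_index; case: xgetP => [i _ iP|no].
  by exists i; split => //; exact: lne_prod_leveled.
by have [i /no] := exists_split.
Qed.

End Split.

(** * Invariance under extra zero eigenvalues *)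

Section Padding.
Variable R : realType.

(** Nonnegativity of the eigenvalues is what lets the new zeros go at the end without breaking the
    order. *)
Lemma is_spectrum_pad k d (X : 'M[R]_k) (X' : 'M[R]_(k + d)) (lam : k.-tuple R) :
  char_poly X' = char_poly X * 'X^d ->
  is_spectrum X lam -> is_spectrum X' [tuple of lam ++ nseq d 0].
Proof.
move=> X'E [lamS lam0 XE].
split => /=.
- move: lamS; rewrite !(sorted_pairwise ge_trans) pairwise_cat => ->.
  rewrite -(sorted_pairwise ge_trans) andTb; apply/andP; split.
    apply/allrelP => x y /(allP lam0) x0 /nseqP[-> _]; exact: x0.
  by elim: d {X' X'E} => // -[|d] //= ->; rewrite lexx.
- by rewrite all_cat lam0 all_nseq lexx orbT.
- rewrite X'E XE big_cat/=; congr (_ * _).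
  by rewrite big_nseq iter_mulr_1 polyC0 subr0.
Qed.

(** The appended zeros equal the default of [nth], so entries, tail sums and hence the split
    condition are unchanged. *)
Lemma phi_pad k d t (lam : k.-tuple R) : (0 < t)%N -> (t <= k)%N ->
  phi t [tuple of lam ++ nseq d 0] = phi t lam.
Proof.
move=> t0 tk; set lam' := [tuple of _].
have nthE j : lam'`_j = lam`_j.
  rewrite nth_cat nth_nseq if_same; case: ltnP => // h.
  by rewrite nth_default.
have tailE i : (i < t)%N -> tail_mean t lam' i = tail_mean t lam i.
  move=> it; congr (_ / _).
  have ik : (i <= k)%N by rewrite ltnW// (leq_trans it).
  rewrite (big_cat_nat ik (leq_addr d k))/=.
  have -> : \sum_(k <= j < k + d) lam'`_j = 0.
    rewrite big_nat; apply: big1 => j /andP[kj _].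
    by rewrite nthE nth_default ?size_tuple.
  by rewrite addr0; apply: eq_bigr => j _; exact: nthE.
have entryE i : entry lam' i = entry lam i by case: i => //= j; rewrite nthE.
have splitE : split_index t lam' = split_index t lam.
  rewrite /split_index; congr xget; apply/seteqP; split => i [it h].
    by split => //; rewrite -tailE// -!entryE.
  by split => //; rewrite tailE// !entryE.
rewrite /phi splitE.
(* The default value 0 of [split_index] is also below [t]. *)
have it : (split_index t lam < t)%N.
  by rewrite /split_index; case: xgetP => [i _ []|].
rewrite tailE//; congr (_ + _)%E.
by apply: eq_bigr => j _; rewrite nthE.
Qed.

(** The size [k'] is tied to [k + d] by an equation because it will be instantiated with a size that
    is not literally a sum. *)
Lemma Gamma_pad k k' d t (X : 'M[R]_k) (X' : 'M[R]_k') : k' = (k + d)%N ->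
  (0 < t)%N -> (t <= k)%N -> possemidefmx X ->
  char_poly X' = char_poly X * 'X^d -> Gamma t X' = Gamma t X.
Proof.
move=> k'E; move: X'; rewrite {}k'E => X' t0 tk Xp X'E.
have XS := eigenvalues_spectrum Xp.
by rewrite /Gamma (eigenvalues_uniq (is_spectrum_pad X'E XS)) phi_pad.
Qed.

End Padding.

(** * Continuity and closed conditions *)

Section Closedness.
Variables (R : realType) (T : topologicalType).

Lemma continuous_sum_fin I (r : seq I) (F : I -> T -> R) :
  (forall i, continuous (F i)) -> continuous (fun w => \sum_(i <- r) F i w).
Proof. by move=> Fc; apply: continuous_big => //; exact: add_continuous. Qed.

Lemma continuous_prod_fin I (r : seq I) (F : I -> T -> R) :
  (forall i, continuous (F i)) -> continuous (fun w => \prod_(i <- r) F i w).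
Proof. by move=> Fc; apply: continuous_big => //; exact: mul_continuous. Qed.

Lemma continuous_mulr_cst (f : T -> R) c :
  continuous f -> continuous (fun w => f w * c).
Proof. by move=> fc w; apply: cvgM; [exact: fc|exact: cvg_cst]. Qed.

Lemma continuous_det n (M : T -> 'M[R]_n) :
  (forall i j, continuous (fun w => M w i j)) -> continuous (fun w => \det (M w)).
Proof.
move=> Mc; apply: continuous_sum_fin => s w.
by apply: cvgM; [exact: cvg_cst|exact: continuous_prod_fin].
Qed.

Lemma closed_leC (f g : T -> R) : continuous f -> continuous g ->
  closed [set w | f w <= g w].
Proof.
move=> fc gc; rewrite (_ : mkset _ = (fun w => g w - f w) @^-1` [set x | 0 <= x]).
  apply: preimage_closed; last exact: closed_ge.
  by move=> w _; apply: cvgB; [exact: gc|exact: fc].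
by apply/seteqP; split => w /=; rewrite subr_ge0.
Qed.

Lemma closed_eqC (f g : T -> R) : continuous f -> continuous g ->
  closed [set w | f w = g w].
Proof.
move=> fc gc; rewrite (_ : mkset _ = [set w | f w <= g w] `&` [set w | g w <= f w]).
  by apply: closedI; exact: closed_leC.
apply/seteqP; split => w /= => [->|[h1 h2]]; first by rewrite lexx.
by apply/eqP; rewrite eq_le h1 h2.
Qed.

Lemma closed_forall I (P : I -> T -> Prop) :
  (forall i, closed [set w | P i w]) -> closed [set w | forall i, P i w].
Proof.
move=> Pc; rewrite (_ : mkset _ = \bigcap_(i in setT) [set w | P i w]).
  exact: closed_bigI.
by apply/seteqP; split => w /= h i => [_|]; exact: h.
Qed.

End Closedness.

Lemma is_spectrum_trace (R : realType) k (X : 'M[R]_k) (lam : k.-tuple R) :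
  is_spectrum X lam -> \sum_(x <- lam) x = \tr X.
Proof.
move=> [_ _ XE]; have [k0|k0] := posnP k.
  subst k; rewrite tuple0 big_nil/= /mxtrace big_ord0//.
apply: oppr_inj; rewrite -char_poly_trace// XE.
by rewrite -coefPn_prod_XsubC ?size_tuple// -lt0n.
Qed.

(** * Attainment of the maximum of Gamma *)

Section GammaMax.
Variables (R : realType) (n k t : nat).
Variables (X : 'rV[R]_n -> 'M[R]_k) (Z : set 'rV[R]_n).
Hypotheses (t_gt0 : (0 < t)%N) (le_tk : (t <= k)%N).
Hypotheses (Zc : compact Z) (Z0 : Z !=set0).
Hypothesis Xc : forall i j, continuous (fun z => X z i j).
Hypothesis Xp : forall z, Z z -> possemidefmx (X z).

Let T : topologicalType := ('rV[R]_n * ('rV[R]_k * 'rV[R]_t))%type.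

(** Here [w] is the triple (z, lam, mu). The factorization of the characteristic polynomial is
    imposed at each point [x], so that each instance equates two continuous functions of [w]. *)
Let constraints (w : T) : Prop :=
  [/\ forall ij : 'I_k * 'I_k, (ij.1 <= ij.2)%N -> w.2.1 0 ij.2 <= w.2.1 0 ij.1,
      forall x, \det (x%:M - X w.1) = \prod_i (x - w.2.1 0 i),
      forall j : 'I_t, w.2.1 0 (widen_ord le_tk j) <= w.2.2 0 j
    & \sum_j w.2.2 0 j = \sum_i w.2.1 0 i].

Let box m (C : R) : set 'rV[R]_m := [set v | forall i, v 0 i \in `[0, C]].

Let lift_set (C : R) : set T :=
  (Z `*` (@box k C `*` @box t C)) `&` [set w | constraints w].

Let box_compact m C : compact (@box m C).
Proof.
apply: (@rV_compact _ _ (fun=> `[0, C]%classic)).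
by move=> _; exact: segment_compact.
Qed.

Let cont1 : continuous (fun w : T => w.1).
Proof. by move=> w; exact: cvg_fst. Qed.

Let cont21 i : continuous (fun w : T => w.2.1 0 i).
Proof.
move=> w; apply: (@continuous_comp _ _ _ (fun w : T => w.2.1) (fun v => v 0 i)).
  by apply: (@continuous_comp _ _ _ snd fst); [exact: cvg_snd|exact: cvg_fst].
exact: coord_continuous.
Qed.

Let cont22 i : continuous (fun w : T => w.2.2 0 i).
Proof.
move=> w; apply: (@continuous_comp _ _ _ (fun w : T => w.2.2) (fun v => v 0 i)).
  by apply: (@continuous_comp _ _ _ snd snd); exact: cvg_snd.
exact: coord_continuous.
Qed.

Let lift_set_compact C : compact (lift_set C).
Proof.
apply: compact_closedI.
  apply: compact_setX => //.
  by apply: compact_setX; exact: box_compact.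
rewrite (_ : mkset _ =
  [set w : T | forall ij : 'I_k * 'I_k,
    (ij.1 <= ij.2)%N -> w.2.1 0 ij.2 <= w.2.1 0 ij.1] `&`
  ([set w : T | forall x, \det (x%:M - X w.1) = \prod_i (x - w.2.1 0 i)] `&`
  ([set w : T | forall j : 'I_t, w.2.1 0 (widen_ord le_tk j) <= w.2.2 0 j] `&`
   [set w : T | \sum_j w.2.2 0 j = \sum_i w.2.1 0 i]))); last first.
  by apply/seteqP; split => w; [case|case=> ? [? []]].
repeat apply: closedI.
- apply: closed_forall => -[i j] /=; apply: closed_forall => _.
  exact: closed_leC.
- apply: closed_forall => x; apply: closed_eqC.
    apply: continuous_det => i j w; under eq_fun do rewrite !mxE.
    apply: cvgB; first exact: cvg_cst.
    apply: (@continuous_comp _ _ _ fst (fun z => X z i j)); last exact: Xc.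
    exact: cont1.
  apply: continuous_prod_fin => i w.
  by apply: cvgB; [exact: cvg_cst|exact: cont21].
- by apply: closed_forall => j; exact: closed_leC.
- by apply: closed_eqC; apply: continuous_sum_fin.
Qed.

Let spec_of (w : T) : k.-tuple R := [tuple w.2.1 0 i | i < k].

Let spec_ofE w (i : 'I_k) : (spec_of w)`_i = w.2.1 0 i.
Proof. by rewrite nth_mktuple. Qed.

Let spec_of_sum w : \sum_(x <- spec_of w) x = \sum_i w.2.1 0 i.
Proof. by rewrite big_tuple; apply: eq_bigr => i _; rewrite tnth_mktuple. Qed.

Let lift_set_spectrum C w : lift_set C w -> is_spectrum (X w.1) (spec_of w).
Proof.
move=> [[_ [/= lam0 _]] [lamS lamX _ _]]; split.
- apply/(sortedP 0) => i; rewrite size_tuple => ik.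
  rewrite (spec_ofE w (Ordinal ik)) (spec_ofE w (Ordinal (ltnW ik))).
  by apply: (lamS (_, _)) => /=.
- apply/allP => x /tnthP[i ->]; rewrite tnth_mktuple.
  by have := lam0 i; rewrite in_itv/= => /andP[].
- apply: horner_ext => x; rewrite horner_char_poly lamX horner_prod big_tuple.
  by apply: eq_bigr => i _; rewrite !hornerE tnth_mktuple.
Qed.

Let obj (w : T) : R := \prod_j w.2.2 0 j.

Let obj_ge0 C w : lift_set C w -> 0 <= obj w.
Proof.
move=> [[_ [_ /= mu0]] _]; apply: prodr_ge0 => j _.
by have := mu0 j; rewrite in_itv/= => /andP[].
Qed.

(** Every feasible [mu] bounds Gamma from below, by [prod_le_leveled]. *)
Let obj_le_Gamma C w : lift_set C w -> (lne (obj w)%:E <= Gamma t (X w.1))%E.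
Proof.
move=> wK; have wS := lift_set_spectrum wK; have [lamS lam0 _] := wS.
rewrite /Gamma (eigenvalues_uniq wS).
have [i [iP ->]] := phi_leveled t_gt0 le_tk lamS lam0.
have le : obj w <= \prod_(j < t) leveled t (spec_of w) i j.
  case: wK => _ [_ _ mu_ge mu_sum]; apply: prod_le_leveled => //.
    by move=> j; have := mu_ge j; rewrite -spec_ofE.
  by rewrite spec_of_sum.
have w0 := obj_ge0 wK.
by rewrite lee_lne ?in_itv/= ?leey ?andbT ?lee_fin// (le_trans w0).
Qed.

(** A single [C] serves all [z]: the entries of [lam] and of [mu] are nonnegative with sum the trace
    of [X z], which is at most its maximum over the compact [Z]. *)
Let exists_lift : exists C, forall z, Z z ->
  exists w, [/\ lift_set C w, w.1 = z & Gamma t (X z) = lne (obj w)%:E].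
Proof.
have [|c _ cmax] := @compact_EVT_max _ R (fun z => \tr (X z)) Z Z0 Zc.
  apply: continuous_subspaceT.
  by apply: continuous_sum_fin => i; exact: Xc.
exists (\tr (X c)) => z Zz.
have zS := eigenvalues_spectrum (Xp Zz); have [lamS lam0 lamX] := zS.
set lam := eigenvalues (X z) in zS lamS lam0 lamX.
have [i [iP phiE]] := phi_leveled t_gt0 le_tk lamS lam0.
(* The leveled vector turns the AM-GM bound into an equality. *)
pose w : T := (z, (\row_i lam`_i, \row_j leveled t lam i j)).
have trE : \sum_(i < k) lam`_i = \tr (X z).
  rewrite -(is_spectrum_trace zS) big_tuple.
  by apply: eq_bigr => j _; rewrite (tnth_nth 0).
have trC : \tr (X z) <= \tr (X c) by apply: cmax; rewrite inE.
have lam_ge0 := nth_spectrum_ge0 lam0.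
have mu_ge0 := leveled_ge0 lamS lam0 iP.
exists w; split => //; last first.
  by rewrite /Gamma phiE; congr (lne _%:E); apply: eq_bigr => j _; rewrite mxE.
split; split => //=.
- split => j /=; rewrite mxE in_itv/= ?lam_ge0 ?mu_ge0 /=.
    apply: le_trans trC; rewrite -trE (bigD1 j)//= lerDl.
    by apply: sumr_ge0 => l _; exact: lam_ge0.
  apply: le_trans trC; rewrite -(is_spectrum_trace zS) -(leveled_sum le_tk iP).
  rewrite (bigD1 j)//= lerDl.
  by apply: sumr_ge0 => l _; exact: mu_ge0.
- by move=> [j l] /= jl; rewrite !mxE; exact: nth_spectrum_antitone.
- move=> x; rewrite -horner_char_poly lamX horner_prod big_tuple.
  by apply: eq_bigr => j _; rewrite !hornerE mxE (tnth_nth 0).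
- by move=> j; rewrite !mxE; exact: leveled_ge.
- under eq_bigr do rewrite mxE.
  rewrite (leveled_sum le_tk iP) (is_spectrum_trace zS) -trE.
  by apply: eq_bigr => j _; rewrite mxE.
Qed.

(** For a maximiser [c] of [obj], each value of Gamma is [lne (obj w)] for some lift [w], hence at
    most [lne (obj c)], hence at most the value of Gamma at [c.1]. *)
Lemma Gamma_max_attained : exists M, is_max [set Gamma t (X z) | z in Z] M.
Proof.
have [C CP] := exists_lift.
have K0 : lift_set C !=set0.
  by case: Z0 => z /CP[w [wK _ _]]; exists w.
have [|c cK cmax] := @compact_EVT_max _ R obj _ K0 (@lift_set_compact C).
  by apply: continuous_subspaceT; exact: continuous_prod_fin.
rewrite inE in cK.
exists (Gamma t (X c.1)); split; first by exists c.1 => //; case: cK => -[].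
move=> _ [z Zz <-]; have [w [wK _ ->]] := CP z Zz.
apply: le_trans (obj_le_Gamma cK).
rewrite lee_lne ?in_itv/= ?leey ?andbT ?lee_fin ?(obj_ge0 wK) ?(obj_ge0 cK)//.
by apply: cmax; rewrite inE.
Qed.

End GammaMax.

(** * Reducing the W-side matrix to the Phi-side matrix *)

Section Reduction.
Variable R : realType.

Lemma sum_scale_row_outer p k (Phi : 'M[R]_(p, k)) (z : 'rV[R]_p) :
  \sum_i z 0 i *: ((row i Phi)^T *m row i Phi) = Phi^T *m diag_mx z *m Phi.
Proof.
apply/matrixP => a b; rewrite summxE mul_mx_diag !mxE.
apply: eq_bigr => i _; rewrite !mxE big_ord1 !mxE.
by rewrite mulrCA mulrA.
Qed.

Lemma possemidef_gram p k (Phi : 'M[R]_(p, k)) (z : 'rV[R]_p) :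
  (forall i, 0 <= z 0 i) -> possemidefmx (Phi^T *m diag_mx z *m Phi).
Proof.
move=> z0; split; first by rewrite !trmx_mul tr_diag_mx trmxK mulmxA.
move=> v; rewrite !mulmxA -(mulmxA _ Phi) mul_mx_diag mxE.
apply: sumr_ge0 => i _; rewrite mxE mulrAC.
rewrite -[v *m Phi^T]trmxK trmx_mul trmxK mxE -expr2.
by rewrite mulr_ge0 ?sqr_ge0.
Qed.

Lemma Gamma_block_eq p q k' t (W : 'M[R]_(p + q, k')) (Phi : 'M[R]_p)
    (z : 'rV[R]_p) :
  (p <= k')%N -> (k' <= p + q)%N -> (0 < t)%N -> (t <= p)%N ->
  (forall i, 0 <= z 0 i) -> ulsubmx (W *m W^T) = Phi *m Phi^T ->
  Gamma t (W^T *m diag_mx (row_mx z 0) *m W) =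
  Gamma t (\sum_i z 0 i *: ((row i Phi)^T *m row i Phi)).
Proof.
move=> pk' k'pq t0 tp z0 WPhi; rewrite sum_scale_row_outer.
apply: (@Gamma_pad _ p k' (k' - p)) => //; [lia|exact: possemidef_gram|].
have X0 i : 'X^i != 0 :> {poly R} by rewrite -size_poly_gt0 size_polyXn.
(* Once [W] is cycled to the other side, the last [q] rows vanish and the matrix is block upper
   triangular. *)
have E1 : char_poly (W^T *m diag_mx (row_mx z 0) *m W) * 'X^(p + q) =
    char_poly (diag_mx z *m (Phi *m Phi^T)) * 'X^q * 'X^k'.
  rewrite -mulmxA char_poly_mulmxC -mulmxA -WPhi; congr (_ * _).
  rewrite -[W *m W^T in LHS]submxK diag_mx_row mulmx_block.
  rewrite raddf0 !mul0mx !addr0.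
  exact: char_poly_ublock0.
have E2 : char_poly (diag_mx z *m (Phi *m Phi^T)) =
    char_poly (Phi^T *m diag_mx z *m Phi).
  by apply: (mulIf (X0 p)); rewrite -!mulmxA mulmxA char_poly_mulmxC.
(* Cancelling [X^(p + q)] leaves exactly [k' - p] extra zero eigenvalues. *)
apply: (mulIf (X0 (p + q)%N)); rewrite E1 E2 -!mulrA -!exprD.
by congr (_ * 'X^_); lia.
Qed.

Lemma compact_box_slice p (c : R) :
  compact [set z : 'rV[R]_p | \sum_i z 0 i = c /\ forall i, 0 <= z 0 i <= 1].
Proof.
rewrite [X in compact X](_ : _ =
  [set z : 'rV[R]_p | forall i, `[0, 1]%classic (z 0 i)] `&`
  [set z : 'rV[R]_p | \sum_i z 0 i = c]); last first.
  apply/seteqP; split => z /= [h1 h2].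
    by split=> [i|//]; rewrite in_itv; exact: h2.
  by split=> [//|i]; have := h1 i; rewrite in_itv.
apply: compact_closedI.
  apply: (@rV_compact _ _ (fun=> `[0, 1 : R]%classic)) => _; exact: segment_compact.
apply: closed_eqC; last exact: cst_continuous.
by apply: continuous_sum_fin => i; exact: coord_continuous.
Qed.

Lemma cGamma_max_attained p t (Phi : 'M[R]_p) : (0 < t)%N -> (t <= p)%N ->
  exists M, is_max [set Gamma t
        (\sum_i z 0 i *: ((row i Phi)^T *m row i Phi)) | z in
      [set z : 'rV[R]_p | \sum_i z 0 i = t%:R /\
                          forall i, 0 <= z 0 i <= 1]] M.
Proof.
move=> t0 tp; apply: Gamma_max_attained => //.
- exact: compact_box_slice.
- have p0 : 0 < p%:R :> R by rewrite ltr0n (leq_trans t0).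
  (* The uniform vector is feasible because [t <= p]. *)
  exists (const_mx (t%:R / p%:R)); split.
    under eq_bigr do rewrite mxE.
    by rewrite sumr_const card_ord -[LHS]mulr_natr divfK// gt_eqF.
  move=> i; rewrite mxE divr_ge0//= ler_pdivrMr// mul1r ler_nat//.
- move=> i j; under eq_fun do rewrite summxE.
  apply: continuous_sum_fin => l.
  rewrite (_ : (fun z => _) =
    (fun z : 'rV[R]_p => z 0 l * ((row l Phi)^T *m row l Phi) i j)).
    by apply: continuous_mulr_cst; exact: coord_continuous.
  by apply/funext => z; rewrite mxE.
- move=> z [_ z01]; rewrite sum_scale_row_outer; apply: possemidef_gram => i.
  by have /andP[] := z01 i.
Qed.

(** Definiteness makes the [m] rows of [H^T] independent in dimension [q]. The resulting [m <= q]
    gives [p <= p + q - m], so that W has at least [p] columns. *)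
Lemma posdef_gram_leq q m (H : 'M[R]_(q, m)) : posdefmx (H^T *m H) -> (m <= q)%N.
Proof.
move=> [_ Hp]; suff /eqP <- : row_free H^T by exact: rank_leq_col.
apply: inj_row_free => v vH; apply/eqP/negP => /negP v0.
have := Hp v^T; rewrite trmxK trmx_eq0 => /(_ v0).
by rewrite mulmxA vH !mul0mx mxE ltxx.
Qed.

(** * Determinant and projection from the singular-value decomposition *)

Section Svd.
Variables (n m : nat) (A U : 'M[R]_(n, m)) (Sigma V : 'M[R]_m).
Hypothesis svd : compact_svd A U Sigma V.

Lemma svd_gram : A^T *m A = (Sigma *m V^T)^T *m (Sigma *m V^T).
Proof.
have [-> _ UU _] := svd.
rewrite -mulmxA [in LHS]trmx_mul -mulmxA [U^T *m _]mulmxA UU mul1mx//.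
Qed.

Lemma svd_det : \det Sigma = \prod_i Sigma i i.
Proof.
by have [_ [Sd _] _ _] := svd; rewrite det_trig// is_diag_mx_is_trig.
Qed.

Lemma svd_det_gt0 : 0 < \prod_i Sigma i i.
Proof. by have [_ [_ S0] _ _] := svd; apply: prodr_gt0 => i _. Qed.

Lemma svd_core_unit : Sigma *m V^T \in unitmx.
Proof.
have [_ _ _ [_ VV]] := svd; rewrite unitmx_mul (mulmx1_unit VV).2 andbT.
by rewrite unitmxE svd_det unitfE gt_eqF ?svd_det_gt0.
Qed.

Lemma ldet_svd_gram : ldet (A^T *m A) = (2 * \sum_i ln (Sigma i i))%:E.
Proof.
have [_ [_ S0] _ [_ VV]] := svd.
have V2 : \det V * \det V = 1 by rewrite -[X in _ * X]det_tr -det_mulmx VV det1.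
have -> : ldet (A^T *m A) = lne ((\prod_i Sigma i i) ^+ 2)%:E.
  rewrite /ldet svd_gram det_mulmx det_tr det_mulmx det_tr svd_det.
  by rewrite mulrACA V2 mulr1.
rewrite lne_EFin ?exprn_gt0 ?svd_det_gt0// lnXn ?svd_det_gt0//.
by rewrite ln_prod// mulr_natl.
Qed.

(** Write [A = U K] with [K = Sigma V^T] invertible; then [K (K^T K)^-1 K^T = 1]. *)
Lemma svd_projection : U *m U^T = A *m invmx (A^T *m A) *m A^T.
Proof.
have [AE _ _ _] := svd; rewrite -mulmxA in AE.
have Ku := svd_core_unit; rewrite svd_gram {}AE.
move: (Sigma *m V^T) Ku => K Ku.
have Gu : K^T *m K \in unitmx by rewrite unitmx_mul unitmx_tr Ku.
have KNK : K *m (invmx (K^T *m K) *m K^T) = 1%:M.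
  by apply: mulmx1C; rewrite -mulmxA mulVmx.
by rewrite trmx_mul -!mulmxA (mulmxA _ K^T) (mulmxA K) KNK mul1mx.
Qed.

End Svd.
End Reduction.

(** * Equality of the two bounds *)

Theorem theorem9 (R : realType) (p q m s : nat)
    (G : 'M[R]_(p, m)) (H : 'M[R]_(q, m))
    (U : 'M[R]_(p + q, m)) (Sigma V : 'M[R]_m)
    (W : 'M[R]_(p + q, p + q - m)) (Phi : 'M[R]_p)
    (hA : \rank (col_mx G H) = m)
    (hB : posdefmx (H^T *m H))
    (hs : (0 < s - q < p)%N)
    (hsvd : compact_svd (col_mx G H) U Sigma V)
    (hW : 1%:M - U *m U^T = W *m W^T)
    (hPhi : cholesky Phi (cGamma_mx G (H^T *m H))) :
  exists2 v : \bar R,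
    is_Gamma_bound s [set rshift p j | j : 'I_q]%SET Sigma W v
  & is_cGamma_bound (s - q) G (H^T *m H) Phi v.
Proof.
have mq := posdef_gram_leq hB; have [_ _ PhiE] := hPhi.
have [t0 tp] : (0 < p - (s - q))%N /\ (p - (s - q) <= p)%N by lia.
(* Since [0 < s - q], the truncated subtraction is a true one. *)
have tE : (p + q - s = p - (s - q))%N by lia.
have gramE : (col_mx G H)^T *m col_mx G H = H^T *m H + G^T *m G.
  by rewrite tr_col_mx mul_row_col addrC.
(* The leading block of [1 - A (A^T A)^-1 A^T] involves only the rows of [G], and is [cGamma_mx]. *)
have WPhi : ulsubmx (W *m W^T) = Phi *m Phi^T.
  rewrite -hW (svd_projection hsvd) gramE mul_col_mx tr_col_mx mul_col_row.
  by rewrite scalar_mx_block opp_block_mx add_block_mx block_mxKul PhiE.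
have GammaE (z : 'rV[R]_p) : (forall i, 0 <= z 0 i) ->
    Gamma (p + q - s) (W^T *m diag_mx (row_mx z 0) *m W) =
    Gamma (p - (s - q)) (\sum_i z 0 i *: ((row i Phi)^T *m row i Phi)).
  by move=> z0; rewrite tE; apply: Gamma_block_eq => //; lia.
have [M Mmax] := cGamma_max_attained Phi t0 tp.
exists (ldet (H^T *m H + G^T *m G) + M)%E; last by exists M.
exists M; last by rewrite -(ldet_svd_gram hsvd) gramE.
(* The two sets of values are equal, through the correspondence between [z] and [y = (z, 0)], so the
   attained maximum transfers. *)
apply: (@eq_ind_r _ _ (fun S => is_max S M) Mmax).
apply/seteqP; split => _ [y + <-].
- move=> [ysum y01 yQ].
  have yE : y = row_mx (lsubmx y) 0.
    rewrite -[LHS]hsubmxK; congr row_mx; apply/rowP => j; rewrite !mxE.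
    by apply: yQ; apply/imsetP; exists j.
  exists (lsubmx y); last first.
    by rewrite [in RHS]yE GammaE// => i; rewrite mxE; case/andP: (y01 (lshift q i)).
  split; last by move=> i; rewrite mxE.
  rewrite -tE -ysum big_split_ord/= [X in _ = _ + X]big1 ?addr0.
    by apply: eq_bigr => i _; rewrite mxE.
  by move=> j _; apply: yQ; apply/imsetP; exists j.
- move=> [ysum y01]; exists (row_mx y 0); last first.
    by rewrite GammaE// => i; case/andP: (y01 i).
  split.
  + rewrite big_split_ord/= [X in _ + X]big1 ?addr0.
      by rewrite tE -ysum; apply: eq_bigr => i _; rewrite row_mxEl.
    by move=> j _; rewrite row_mxEr mxE.
  + move=> i; case: (split_ordP i) => j ->; first by rewrite row_mxEl.
    by rewrite row_mxEr mxE lexx ler01.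
  + by move=> _ /imsetP[j _ ->]; rewrite row_mxEr mxE.
Qed.
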